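(* Let $\hat{\mathbf g}_{mk}\in\mathbb C^N$ be the estimated channel from AP $m$ to receiver $k$, with $\hat{\mathbf g}_{mk}\sim\mathcal{CN}(\bar{\mathbf g}_{mk},\boldsymbol\Sigma_{mk})$. Then its fourth-order moment $\bar a_{mk}\triangleq\mathbb E\{\|\hat{\mathbf g}_{mk}\|^4\}=\mathbb E\{|\hat{\mathbf g}_{mk}^\dagger\hat{\mathbf g}_{mk}|^2\}$ is $$\bar a_{mk}=|\mathrm{tr}(\boldsymbol\Sigma_{mk})|^2+|\mathrm{tr}(\boldsymbol\Sigma_{mk}\boldsymbol\Sigma_{mk})|+|\bar{\mathbf g}_{mk}^\dagger\bar{\mathbf g}_{mk}|^2+2\,\bar{\mathbf g}_{mk}^\dagger\bar{\mathbf g}_{mk}\,\mathrm{tr}(\boldsymbol\Sigma_{mk})+2\,\bar{\mathbf g}_{mk}^\dagger\boldsymbol\Sigma_{mk}\bar{\mathbf g}_{mk}.$$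
   Context: $(\cdot)^\dagger$ is the Hermitian transpose, and $\mathcal{CN}(\mathbf u,\boldsymbol\Sigma)$ denotes the circularly symmetric complex Gaussian law with mean $\mathbf u$ and covariance $\boldsymbol\Sigma$. In the paper's setting, $\mathbf F_m\in\mathbb C^{S\times N}$ is a deterministic matrix (the aggregate response of the stacked metasurface at AP $m$), $\bar{\mathbf z}_{mk}\in\mathbb C^S$ is a deterministic line-of-sight vector, $\kappa$ is the Ricean factor, $\bar\beta_{mk}>0$ is a (scaled) large-scale fading coefficient, $\bar{\mathbf g}_{mk}=\sqrt{\bar\beta_{mk}\kappa}\,\mathbf F_m^\dagger\bar{\mathbf z}_{mk}$, $\mathcal P_k$ is the set of receivers (including $k$) sharing the pilot of $k$, $\tau$ is the pilot length, $\rho_u$ the uplink SNR, $\sigma_n^2$ the noise variance, and $$\boldsymbol\Sigma_{mk}=\sqrt{\tau\rho_u}\,\bar\beta_{mk}\mathbf F_m^\dagger\mathbf F_m\mathbf A_{mk},\qquad \mathbf A_{mk}=\sqrt{\tau\rho_u}\,\bar\beta_{mk}\mathbf F_m^\dagger\mathbf F_m\Big(\tau\rho_u\sum_{k'\in\mathcal P_k}\bar\beta_{mk'}\mathbf F_m^\dagger\mathbf F_m+\sigma_n^2\mathbf I_N\Big)^{-1}.$$ *)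

(* Defs.v *)
From mathcomp Require Import all_boot all_order all_algebra.
From mathcomp Require Import sesquilinear spectral.
From mathcomp Require Import complex.
From mathcomp Require Import all_classical all_reals all_analysis.

Set Implicit Arguments.
Unset Strict Implicit.
Unset Printing Implicit Defensive.

Import Order.TTheory GRing.Theory Num.Theory.
Import numFieldNormedType.Exports.

Local Open Scope classical_set_scope.
Local Open Scope complex_scope.
Local Open Scope sesquilinear_scope.
Local Open Scope ring_scope.

Definition cdot {R : realType} {n : nat} (u v : 'cV[R[i]]_n) : R[i] :=
  (u^t* *m v) 0 0.

(* The norm of the normed-module structure on matrices is the sup norm,
   hence this separate Euclidean norm. *)
Definition enorm {R : realType} {n : nat} (v : 'cV[R[i]]_n) : R :=
  Num.sqrt (\sum_(i < n) Normc.normc (v i 0) ^+ 2).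

(* Real Gaussian law with mean m and standard deviation s. The degenerate
   case s = 0 must be the point mass at m, whereas normal_prob m 0 is by
   convention the uniform law on [0, 1]. *)
Definition gauss_law {R : realType} (m s : R) (A : set R) : \bar R :=
  if s == 0 then \d_m A else normal_prob m s A.

Section ComplexGaussian.
Context {d : measure_display} {T : measurableType d} {R : realType}.
Variable P : probability T R.

Definition cexpectation (Z : T -> R[i]) : R[i] :=
  fine 'E_P[fun t => complex.Re (Z t)] +i* fine 'E_P[fun t => complex.Im (Z t)].

Definition mexpectation {p q : nat} (Z : T -> 'M[R[i]]_(p, q)) : 'M[R[i]]_(p, q) :=
  \matrix_(i, j) cexpectation (fun t => Z t i j).

Definition random_cvector {n : nat} (X : T -> 'cV[R[i]]_n) : Prop :=
  forall i : 'I_n, measurable_fun setT (fun t => complex.Re (X t i 0)) /\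
                   measurable_fun setT (fun t => complex.Im (X t i 0)).

(* Joint Gaussianity of the real and imaginary parts: as w ranges over C^n,
   t |-> Re (w^dagger X) ranges over all their real linear combinations. *)
Definition jointly_gaussian {n : nat} (X : T -> 'cV[R[i]]_n) : Prop :=
  forall w : 'cV[R[i]]_n, exists m s : R, forall A : set R, measurable A ->
    pushforward P (fun t => complex.Re (cdot w (X t))) A = gauss_law m s A.

(* X ~ CN(u, S): circular symmetry of X - u is the vanishing of its
   pseudo-covariance E[(X - u)(X - u)^T]. The expectations are finite because
   the components of a jointly Gaussian vector have moments of all orders. *)
Definition complex_gaussian {n : nat} (X : T -> 'cV[R[i]]_n)
    (u : 'cV[R[i]]_n) (S : 'M[R[i]]_n) : Prop :=
  [/\ random_cvector X /\ jointly_gaussian X,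
      mexpectation X = u,
      mexpectation (fun t => (X t - u) *m (X t - u)^t*) = S &
      mexpectation (fun t => (X t - u) *m (X t - u)^T) = 0].

End ComplexGaussian.

Section Channel.
Context {R : realType} {M K S N : nat} {L : eqType}.
Variables (F : 'I_M -> 'M[R[i]]_(S, N)) (zbar : 'I_M -> 'I_K -> 'cV[R[i]]_S).
Variables (beta : 'I_M -> 'I_K -> R) (kappa : R) (pilot : 'I_K -> L).
Variables (tau : nat) (rhou sigman2 : R).

Definition pilot_sharers (k : 'I_K) : {set 'I_K} :=
  [set k' | pilot k' == pilot k].

Definition gbar (m : 'I_M) (k : 'I_K) : 'cV[R[i]]_N :=
  (Num.sqrt (beta m k * kappa))%:C *: ((F m)^t* *m zbar m k).

Definition pilot_cov (m : 'I_M) (k : 'I_K) : 'M[R[i]]_N :=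
  (tau%:R * rhou)%:C *:
    (\sum_(k' in pilot_sharers k) (beta m k')%:C *: ((F m)^t* *m F m))
  + (sigman2%:C)%:M.

(* pilot_cov m k is positive definite as soon as sigman2 > 0, rhou >= 0 and
   beta >= 0, so invmx is then its genuine inverse. *)
Definition Amat (m : 'I_M) (k : 'I_K) : 'M[R[i]]_N :=
  (Num.sqrt (tau%:R * rhou) * beta m k)%:C *:
    ((F m)^t* *m F m *m invmx (pilot_cov m k)).

Definition Sigma (m : 'I_M) (k : 'I_K) : 'M[R[i]]_N :=
  (Num.sqrt (tau%:R * rhou) * beta m k)%:C *: ((F m)^t* *m F m *m Amat m k).

End Channel.

(* Main.v *)
Require Import Defs.
From mathcomp Require Import all_boot all_order all_algebra.
From mathcomp Require Import sesquilinear spectral.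
From mathcomp Require Import complex.
From mathcomp Require Import all_classical all_reals all_analysis.
From mathcomp Require Import measurable_realfun ring lra.

(* A real Gaussian variable Y satisfies E Y^4 = 3 (E Y^2)^2 - 2 (E Y)^4, the
   central moments coming from the recursion
   E (Y - m)^(k+1) = k s^2 E (Y - m)^(k-1) (integration by parts). Polarizing
   over the combinations a Y1 + b Y2 gives, for a jointly Gaussian pair,
   E Y1^2 Y2^2 = E Y1^2 E Y2^2 + 2 (E Y1 Y2)^2 - 2 (E Y1)^2 (E Y2)^2.
   Summing over all pairs of the 2 N real coordinates of X, with mean m and
   covariance K, yields
   E |X|^4 = (tr K + |m|^2)^2 + 2 tr K^2 + 4 m^T K m.
   The vanishing pseudo-covariance means that K is the real form of S / 2, so
   that tr K = tr S, 2 tr K^2 = tr S^2 and 2 m^T K m = u^dagger S u. *)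

Set Implicit Arguments.
Unset Strict Implicit.
Unset Printing Implicit Defensive.

Import Order.TTheory GRing.Theory Num.Theory.
Import numFieldNormedType.Exports.

Local Open Scope classical_set_scope.
Local Open Scope complex_scope.
Local Open Scope sesquilinear_scope.
Local Open Scope ring_scope.

(** * Moments of the normal law *)

(** The fundamental theorem of calculus on the intervals of radius [n.+1] around [m] gives boundary
    values tending to 0. Dominated convergence, with bound |f|, carries this to the whole line. *)
Lemma integral_derive_eq0 (R : realType) (F f : R -> R) (m : R) :
    (forall x, is_derive x (1:R) F (f x)) -> continuous f ->
    lebesgue_measure.-integrable setT (EFin \o f) ->
    F (m - n.+1%:R) @[n --> \oo] --> (0:R) -> F (m + n.+1%:R) @[n --> \oo] --> (0:R) ->
  (\int[lebesgue_measure]_x (f x)%:E = 0)%E.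
Proof.
move=> dF cf intf FN FP.
pose I n := `[m - n.+1%:R, m + n.+1%:R]%classic.
pose f_ n : R -> \bar R := (EFin \o f) \_ (I n).
have mf : measurable_fun [set: R] f by exact: continuous_measurable_fun.
have mEf : measurable_fun [set: R] (fun x => (f x)%:E) by exact/measurable_EFinP.
have mf_ n : measurable_fun [set: R] (f_ n).
  exact: (measurable_restrictT _ (measurable_itv _)).1 (measurable_funTS mEf).
have f_f x : (f_ n x @[n --> \oo] --> (f x)%:E)%E.
  apply: cvg_near_cst; near=> n.
  rewrite /f_ patchE mem_set//= /I /= in_itv/=.
  have : `|x - m| <= n.+1%:R.
    rewrite (le_trans (ltW (archi_boundP _)))// ler_nat.
    by apply: leqW; near: n; exact: nbhs_infty_ge.
  by rewrite ler_norml; lra.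
have f_le n x : (`|f_ n x| <= `|(f x)%:E|)%E.
  by rewrite /f_ patchE; case: ifPn => //= _; rewrite normr0 lee_fin.
have [_ _] := @dominated_convergence _ (measurableTypeR R) R lebesgue_measure setT
  measurableT f_ (fun x => (f x)%:E) (fun x => `|(f x)%:E|%E) mf_ mEf
  (aeW _ (fun x (_ : [set: measurableTypeR R] x) => f_f x)) (integrable_abse intf)
  (aeW _ (fun x n (_ : [set: measurableTypeR R] x) => f_le n x)).
move/cvg_lim => <-//; apply/cvg_lim => //.
have -> : (fun n => \int[lebesgue_measure]_(x in setT) f_ n x)%E =
    (fun n => (F (m + n.+1%:R) - F (m - n.+1%:R))%:E).
  apply/funext => n; rewrite /f_ -integral_mkcond EFinB.
  apply: continuous_FTC2.
  - by rewrite ltrD2l (@lt_trans _ _ 0)// oppr_lt0.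
  - by apply: continuous_subspaceT.
  - have cF : continuous F.
      move=> x; apply: differentiable_continuous; apply/derivable1_diffP.
      by case: (dF x).
    split; first by move=> x _; case: (dF x).
      by apply: cvg_at_right_filter; exact: cF.
    by apply: cvg_at_left_filter; exact: cF.
  - by move=> x _; rewrite derive1E; case: (dF x).
apply: cvg_EFin; first exact: nearW.
by rewrite -[X in _ --> X](subr0 0); apply: cvgB.
Unshelve. all: by end_near. Qed.

Lemma expR_ge_pow_fact (R : realType) (n : nat) (x : R) :
  0 <= x -> x ^+ n <= n`!%:R * expR x.
Proof.
move=> x0; case: n => [|n].
  by rewrite expr0 fact0 mul1r (le_trans _ (expR_ge1Dx x))// lerDl.
rewrite mulrC -ler_pdivrMr ?ltr0n ?fact_gt0//.
by rewrite (le_trans _ (expR_ge1Dxn n x0))// lerDr.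
Qed.

(* Half of the Gaussian decay absorbs the polynomial factor, so the bound is
   again a normal density, of variance 2 s^2. *)
Lemma normal_pdf_tail (R : realType) (m s : R) (k : nat) : s != 0 ->
  exists2 C, 0 <= C & forall x,
    `|x - m| ^+ k * normal_pdf m s x <= C * normal_pdf m (s * Num.sqrt 2) x.
Proof.
move=> s0.
have s2_gt0 : 0 < s ^+ 2 by rewrite exprn_even_gt0.
have s'0 : s * Num.sqrt 2 != 0 by rewrite mulf_neq0// gt_eqF// sqrtr_gt0.
have s'2 : (s * Num.sqrt 2) ^+ 2 = 2 * s ^+ 2 by rewrite exprMn sqr_sqrtr// mulrC.
have p'_gt0 := normal_peak_gt0 s'0.
have p_gt0 := normal_peak_gt0 s0.
(* [c] bounds |x - m|^k exp(-u), where u = (x - m)^2 / (4 s^2) is half of the Gaussian exponent: y^k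
   <= 1 + y^(2k) for y = |x - m|, and y^(2k) = (4 s^2)^k u^k <= (4 s^2)^k k! exp(u). The quotient of
   peaks in the witness below only changes the normalization. *)
pose c := 1 + (4 * s ^+ 2) ^+ k * k`!%:R.
have c_ge0 : 0 <= c by rewrite addr_ge0// mulr_ge0// exprn_ge0// mulr_ge0// ltW.
exists (c * (normal_peak s / normal_peak (s * Num.sqrt 2))).
  by rewrite mulr_ge0// divr_ge0// ltW.
move=> x; rewrite !normal_pdfE// /normal_fun s'2.
pose u := (x - m) ^+ 2 / (4 * s ^+ 2).
have u_ge0 : 0 <= u by rewrite divr_ge0 ?sqr_ge0// mulr_ge0// ltW.
have -> : - (x - m) ^+ 2 / (s ^+ 2 *+ 2) = - u - u by rewrite /u; field.
have -> : - (x - m) ^+ 2 / ((2 * s ^+ 2) *+ 2) = - u by rewrite /u; field.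
have H : `|x - m| ^+ k * expR (- u) <= c.
  have y_le : `|x - m| ^+ k <= 1 + (x - m) ^+ (2 * k).
    rewrite exprM -real_normK ?num_real// -exprM mulnC exprM.
    have := sqr_ge0 (`|x - m| ^+ k - 1); have := sqr_ge0 (`|x - m| ^+ k); nra.
  have pow_le : (x - m) ^+ (2 * k) <= (4 * s ^+ 2) ^+ k * (k`!%:R * expR u).
    have -> : (x - m) ^+ (2 * k) = (4 * s ^+ 2) ^+ k * u ^+ k.
      by rewrite -exprMn /u exprM; congr (_ ^+ k); field.
    by rewrite ler_pM2l ?exprn_gt0// ?expR_ge_pow_fact// mulr_gt0.
  rewrite expRN ler_pdivrMr ?expR_gt0//.
  have e1 : 1 <= expR u by rewrite -[leLHS]expR0 ler_expR.
  rewrite (le_trans y_le)// (le_trans (lerD e1 pow_le))//.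
  by rewrite /c [leRHS]mulrDl mul1r mulrA.
rewrite expRD.
have -> : c * (normal_peak s / normal_peak (s * Num.sqrt 2)) *
    (normal_peak (s * Num.sqrt 2) * expR (- u)) = c * (normal_peak s * expR (- u)).
  by field; rewrite gt_eqF.
have -> : `|x - m| ^+ k * (normal_peak s * (expR (- u) * expR (- u))) =
    `|x - m| ^+ k * expR (- u) * (normal_peak s * expR (- u)) by ring.
by rewrite ler_wpM2r// mulr_ge0 ?expR_ge0// ltW.
Qed.

Lemma is_derive_normal_pdf (R : realType) (m s x : R) : s != 0 ->
  is_derive x (1:R) (normal_pdf m s) (- ((x - m) / s ^+ 2) * normal_pdf m s x).
Proof.
move=> s0; rewrite normal_pdfE// /normal_fun.
apply: is_derive_eq.
by rewrite /GRing.scale/=; field.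
Qed.

Lemma integrable_normal_pdf_moment (R : realType) (m s : R) (k : nat) : s != 0 ->
  lebesgue_measure.-integrable [set: R]
    (fun x => ((x - m) ^+ k * normal_pdf m s x)%:E).
Proof.
move=> s0; have [C C0 H] := normal_pdf_tail m k s0.
have intC := integrableZl measurableT C (integrable_normal_pdf m (s * Num.sqrt 2)).
apply: le_integrable intC => //.
  apply/measurable_EFinP; apply: measurable_funM; last exact: measurable_normal_pdf.
  by apply: measurable_funX; exact: measurable_funB.
move=> x _; rewrite -EFinM !abse_EFin lee_fin.
rewrite [leLHS]normrM normrX (ger0_norm (normal_pdf_ge0 _ _ _)).
by rewrite (le_trans (H x))// ler_norm.
Qed.

Lemma cvg_normal_pdf_moment (R : realType) (m s : R) (k : nat) (u : R ^nat) :
    s != 0 -> (forall n, `|u n - m| = n.+1%:R) ->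
  (u n - m) ^+ k * normal_pdf m s (u n) @[n --> \oo] --> (0:R).
Proof.
(* The tail bound is taken with exponent [k.+1]: the spare factor |u n - m| = n + 1 turns it into a
   multiple of the harmonic sequence. *)
move=> s0 um; have [C C0 H] := normal_pdf_tail m k.+1 s0.
have s'0 : s * Num.sqrt 2 != 0 by rewrite mulf_neq0// gt_eqF// sqrtr_gt0.
apply: norm_cvg0.
apply: (@squeeze_cvgr _ _ _ _ (cst 0)
  (fun n => C * normal_peak (s * Num.sqrt 2) * harmonic n)).
- apply: nearW => n; rewrite normr_ge0/= normrM normrX.
  rewrite (ger0_norm (normal_pdf_ge0 _ _ _)) um ler_pdivlMr ?ltr0n// mulrAC -exprSr.
  rewrite -um (le_trans (H _))// ler_wpM2l//; exact: normal_pdf_ub.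
- exact: cvg_cst.
- rewrite -[X in _ --> X](mulr0 (C * normal_peak (s * Num.sqrt 2))).
  by apply: cvgMr; exact: cvg_harmonic.
Qed.

(* For k = 0 the junk value 0.-1 = 0 is harmless: the right-hand side is 0. *)
Lemma normal_pdf_moment_rec (R : realType) (m s : R) (k : nat) : s != 0 ->
  \int[lebesgue_measure]_x ((x - m) ^+ k.+1 * normal_pdf m s x) =
  k%:R * s ^+ 2 * \int[lebesgue_measure]_x ((x - m) ^+ k.-1 * normal_pdf m s x).
Proof.
move=> s0.
(* Integration by parts: [f] is the derivative of [F], which vanishes at infinity, and its two terms
   are the two sides of the recursion divided by s^2. *)
pose F x := (x - m) ^+ k * normal_pdf m s x.
pose f x := k%:R * ((x - m) ^+ k.-1 * normal_pdf m s x) -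
            (s ^+ 2)^-1 * ((x - m) ^+ k.+1 * normal_pdf m s x).
have i1 := integrable_normal_pdf_moment m k.-1 s0.
have i2 := integrable_normal_pdf_moment m k.+1 s0.
have i3 := integrableZl measurableT k%:R i1.
have i4 := integrableZl measurableT (s ^+ 2)^-1 i2.
have : (\int[lebesgue_measure]_x (f x)%:E = 0)%E.
  apply: (@integral_derive_eq0 _ F f m).
  - move=> x; have d := is_derive_normal_pdf m x s0.
    have -> : F = ((fun y => y - m) ^+ k) * normal_pdf m s.
      by apply/funext => y; rewrite /F mulrfctE exprfctE.
    have dX := is_deriveX k (is_deriveB (is_derive_id x 1) (is_derive_cst m x 1)).
    apply: is_derive_eq (is_deriveM dX d) _.
    rewrite /GRing.scale/= /f exprfctE.
    rewrite (_ : (id - cst m) x = x - m)// (exprS (x - m)).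
    by set a := _ ^+ k; set b := _ ^+ k.-1; field.
  - move=> x; rewrite /f.
    have cX j : {for x, continuous (fun y => (y - m) ^+ j * normal_pdf m s y)}.
      apply: continuousM; last exact: continuous_normal_pdf.
      apply: (@continuous_comp _ _ _ (fun y => y - m) (fun y => y ^+ j)).
        by apply: cvgB; [exact: cvg_id|exact: cvg_cst].
      exact: exprn_continuous.
    apply: cvgB; (apply: cvgM; [exact: cvg_cst|exact: cX]).
  - exact: (integrableB measurableT i3 i4).
  - by apply: cvg_normal_pdf_moment => // n; rewrite addrAC subrr sub0r normrN ger0_norm.
  - by apply: cvg_normal_pdf_moment => // n; rewrite addrAC subrr add0r ger0_norm.
move=> /(congr1 fine)/=.
rewrite -/(Rintegral _ _ _) RintegralB// RintegralZl// RintegralZl// => /eqP.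
rewrite subr_eq0 => /eqP; set a := Rintegral _ _ _; set b := Rintegral _ _ _ => ab.
by rewrite mulrAC ab; field.
Qed.

(** * Integration against the normal law *)

Lemma integrable_normal_prob (R : realType) (m s : R) (f : R -> R) :
    measurable_fun setT f ->
    lebesgue_measure.-integrable setT (fun x => (f x * normal_pdf m s x)%:E) ->
  (normal_prob m s).-integrable setT (EFin \o f).
Proof.
move=> mf /integrableP[_ foo]; apply/integrableP; split; first exact/measurable_EFinP.
have dom := normal_prob_dominates m s.
rewrite -(Radon_Nikodym_SigmaFinite.change_of_variables dom)//; last first.
  by apply: measurableT_comp => //; exact/measurable_EFinP.
have mabs : measurable_fun [set: R] (fun x => `|(f x)%:E|%E).
  by apply: measurableT_comp => //; exact/measurable_EFinP.
have mpdf : measurable_fun [set: R] (fun x => (normal_pdf m s x)%:E).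
  by apply/measurable_EFinP; exact: measurable_normal_pdf.
move: foo; under eq_integral => x _.
  rewrite EFinM abseM (@gee0_abs _ (normal_pdf m s x)%:E) ?lee_fin ?normal_pdf_ge0//.
  over.
apply: le_lt_trans; rewrite le_eqVlt; apply/orP; left; apply/eqP.
(* The Radon-Nikodym derivative of [normal_prob] equals [normal_pdf] almost everywhere, as both have
   the same integral over every measurable set. *)
apply: ae_eq_integral => //.
- apply: emeasurable_funM => //.
  exact: measurable_int (Radon_Nikodym_SigmaFinite.f_integrable dom).
- exact: emeasurable_funM.
- apply: ae_eqe_mul2l; apply: integral_ae_eq => //.
  + exact: Radon_Nikodym_SigmaFinite.f_integrable.
  + by move=> E _ mE; rewrite -Radon_Nikodym_SigmaFinite.f_integral.
Qed.

Lemma integral_normal_prob (R : realType) (m s : R) (f : R -> R) :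
    measurable_fun setT f ->
    lebesgue_measure.-integrable setT (fun x => (f x * normal_pdf m s x)%:E) ->
  (\int[normal_prob m s]_x (f x)%:E =
   \int[lebesgue_measure]_x (f x * normal_pdf m s x)%:E)%E.
Proof.
move=> mf intf; have dom := normal_prob_dominates m s.
rewrite -(Radon_Nikodym_change_of_variables dom)//=; last exact: integrable_normal_prob.
under [RHS]eq_integral do rewrite EFinM.
have mEf : measurable_fun [set: R] (fun x => (f x)%:E) by exact/measurable_EFinP.
have mpdf : measurable_fun [set: R] (fun x => (normal_pdf m s x)%:E).
  by apply/measurable_EFinP; exact: measurable_normal_pdf.
apply: ae_eq_integral => //.
- exact: emeasurable_funM.
- exact: emeasurable_funM.
- apply: ae_eqe_mul2l; apply: integral_ae_eq => //.
  + exact: Radon_Nikodym_integrable.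
  + by move=> E _ mE; rewrite -Radon_Nikodym_integral.
Qed.

(** * Transfer from a random variable to its law *)

Section law_of_random_variable.
Context d d' (T : measurableType d) (U : measurableType d') (R : realType).
Variables (P : probability T R) (Y : T -> U) (nu : {measure set U -> \bar R}).
Hypothesis mY : measurable_fun setT Y.
Hypothesis lawY : forall A, measurable A -> pushforward P Y A = nu A.

(** [gauss_law] is a bare set function, so integration is set up for a genuine measure [nu], to be
    either the Dirac mass or the normal law. *)
Lemma integrable_law (f : U -> R) : nu.-integrable setT (EFin \o f) ->
  P.-integrable setT (fun t => (f (Y t))%:E).
Proof.
move=> /integrableP[mf foo]; apply/integrableP; split.
  by apply: (measurableT_comp (f := EFin \o f)).
move: foo; rewrite (@eq_measure_integral _ _ _ _ (pushforward P Y)); last first.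
  by move=> A mA _; rewrite -lawY.
rewrite ge0_integral_pushforward ?preimage_setT//.
exact: measurableT_comp.
Qed.

Lemma Rintegral_law (f : U -> R) : nu.-integrable setT (EFin \o f) ->
  \int[P]_t f (Y t) = \int[nu]_x f x.
Proof.
move=> intf; have intfY := integrable_law intf.
congr fine; have -> : (\int[nu]_x (f x)%:E = \int[pushforward P Y]_x (f x)%:E)%E.
  by apply: eq_measure_integral => A mA _; rewrite -lawY.
by rewrite (integral_pushforward mY)//; case/integrableP: intf.
Qed.

End law_of_random_variable.

Lemma gauss_law_moments d (T : measurableType d) (R : realType) (P : probability T R)
    (Y : T -> R) (m s : R) :
    measurable_fun setT Y ->
    (forall A, measurable A -> pushforward P Y A = gauss_law m s A) ->
  forall k,
  P.-integrable setT (fun t => ((Y t - m) ^+ k)%:E) /\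
  \int[P]_t ((Y t - m) ^+ k.+1) = k%:R * s ^+ 2 * \int[P]_t ((Y t - m) ^+ k.-1).
Proof.
move=> mY lawY.
pose Y' : T -> measurableTypeR R := Y.
pose m' : measurableTypeR R := m.
have mY' : measurable_fun setT Y' by [].
have mX k : measurable_fun [set: R] (fun x => (x - m) ^+ k).
  by apply: measurable_funX; exact: measurable_funB.
have mEX k : measurable_fun [set: R] (EFin \o (fun x => (x - m) ^+ k)).
  exact/measurable_EFinP.
(* For the point mass both sides of the recursion are 0: the left one as 0^(k+1), the right one
   through its factor s^2. *)
have [s0|s0] := eqVneq s 0.
  have lawY0 (A : set (measurableTypeR R)) :
      measurable A -> pushforward P Y' A = \d_m' A.
    by move=> mA; have := lawY A mA; rewrite /gauss_law s0 eqxx.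
  have intX k : (\d_m' : {measure set (measurableTypeR R) -> \bar R}).-integrable setT
      (EFin \o (fun x => (x - m) ^+ k)).
    apply/integrableP; split; first exact: mEX.
    rewrite integral_dirac//; first by rewrite diracT mul1e ltry.
    by apply: measurableT_comp => //; exact: mEX.
  move=> k; split; first exact: integrable_law mY' lawY0 _ (intX k).
  rewrite !(Rintegral_law mY' lawY0 (intX _)) /Rintegral.
  rewrite integral_dirac//; last exact: (mEX k.+1).
  by rewrite diracT mul1e/= subrr s0 [0 ^+ k.+1]expr0n [0 ^+ 2]expr0n mulr0 mul0r.
have lawYn (A : set (measurableTypeR R)) :
    measurable A -> pushforward P Y' A = normal_prob m s A.
  by move=> mA; have := lawY A mA; rewrite /gauss_law (negbTE s0).
have int_phi k := integrable_normal_pdf_moment m k s0.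
have intX k := integrable_normal_prob (mX k) (int_phi k).
move=> k; split; first exact: integrable_law mY' lawYn _ (intX k).
rewrite !(Rintegral_law mY' lawYn (intX _)) /Rintegral !integral_normal_prob//.
exact: normal_pdf_moment_rec.
Qed.

(** * Linear combinations and raw moments *)

Lemma integrable_lincomb d (T : measurableType d) (R : realType)
    (mu : {measure set T -> \bar R}) (I : Type) (r : seq I) (c : I -> R)
    (f : I -> T -> R) :
  (forall i, mu.-integrable setT (EFin \o f i)) ->
  mu.-integrable setT (EFin \o (fun t => \sum_(i <- r) c i * f i t)).
Proof.
move=> intf; elim: r => [|i r IH].
  rewrite (_ : _ \o _ = cst 0%E); first exact: integrable0.
  by apply/funext => t /=; rewrite big_nil.
rewrite (_ : _ \o _ = (fun t => (c i)%:E * (f i t)%:E) \+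
  (fun t => (\sum_(i <- r) c i * f i t)%R%:E))%E.
  exact: (integrableD measurableT (integrableZl measurableT (c i) (intf i)) IH).
by apply/funext => t /=; rewrite big_cons EFinD EFinM.
Qed.

Lemma Rintegral_lincomb d (T : measurableType d) (R : realType)
    (mu : {measure set T -> \bar R}) (I : Type) (r : seq I) (c : I -> R)
    (f : I -> T -> R) :
  (forall i, mu.-integrable setT (EFin \o f i)) ->
  \int[mu]_t (\sum_(i <- r) c i * f i t) = \sum_(i <- r) c i * \int[mu]_t f i t.
Proof.
move=> intf; elim: r => [|i r IH].
  by rewrite big_nil; under eq_Rintegral do rewrite big_nil; rewrite /Rintegral integral0.
under eq_Rintegral do rewrite big_cons.
rewrite RintegralD//; last 2 first.
- exact: (integrableZl measurableT (c i) (intf i)).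
- exact: integrable_lincomb.
by rewrite RintegralZl// IH big_cons.
Qed.

Lemma gauss_law_integrableX d (T : measurableType d) (R : realType)
    (P : probability T R) (Y : T -> R) (m s : R) (k : nat) :
    measurable_fun setT Y ->
    (forall A, measurable A -> pushforward P Y A = gauss_law m s A) ->
  P.-integrable setT (fun t => (Y t ^+ k)%:E).
Proof.
move=> mY /(gauss_law_moments mY) mom.
have := integrable_lincomb (index_enum _) (fun i : 'I_k.+1 => m ^+ i *+ 'C(k, i))
  (fun i => (mom (k - i)%N).1).
apply: eq_integrable => // t _; rewrite /= -[in RHS](subrK m (Y t)) exprDn; congr EFin.
by apply: eq_bigr => i _; rewrite mulrnAl mulrC.
Qed.

(** E Y^4 = 3 s^4 + 6 m^2 s^2 + m^4 and E Y^2 = s^2 + m^2. Eliminating s leaves only raw moments,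
    which expand polynomially in the coefficients of a linear combination. *)
Lemma gauss_law_fourth_moment d (T : measurableType d) (R : realType)
    (P : probability T R) (Y : T -> R) (m s : R) :
    measurable_fun setT Y ->
    (forall A, measurable A -> pushforward P Y A = gauss_law m s A) ->
  \int[P]_t (Y t ^+ 4) =
    3 * (\int[P]_t (Y t ^+ 2)) ^+ 2 - 2 * (\int[P]_t Y t) ^+ 4.
Proof.
move=> mY /(gauss_law_moments mY) mom.
have binom k : \int[P]_t (Y t ^+ k) =
    \sum_(i < k.+1) (m ^+ i *+ 'C(k, i)) * \int[P]_t ((Y t - m) ^+ (k - i)).
  rewrite -Rintegral_lincomb => [|i]; last exact: (mom _).1.
  apply: eq_Rintegral => t _; rewrite -[in LHS](subrK m (Y t)) exprDn.
  by apply: eq_bigr => i _; rewrite mulrnAl mulrC.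
have c0 : \int[P]_t ((Y t - m) ^+ 0) = 1.
  under eq_Rintegral do rewrite expr0.
  by rewrite Rintegral_cst// mul1r; exact: (congr1 fine (probability_setT P)).
(* At k = 0 the factor k makes the recursion yield a vanishing first central moment; the third one
   vanishes in turn. *)
have c1 : \int[P]_t ((Y t - m) ^+ 1) = 0 by rewrite (mom 0%N).2 mul0r mul0r.
have c2 : \int[P]_t ((Y t - m) ^+ 2) = s ^+ 2 by rewrite (mom 1%N).2 c0 mul1r mulr1.
have c3 : \int[P]_t ((Y t - m) ^+ 3) = 0 by rewrite (mom 2%N).2 c1 mulr0.
have c4 : \int[P]_t ((Y t - m) ^+ 4) = 3 * s ^+ 4.
  by rewrite (mom 3%N).2 c2; ring.
have -> : \int[P]_t Y t = m.
  under eq_Rintegral do rewrite -[Y _]expr1.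
  rewrite binom !big_ord_recl big_ord0/= /bump/= !subn0 subnn c0 c1.
  by rewrite mulr0 mulr1 add0r addr0.
have bin4 : ('C(4, 0) = 1) * ('C(4, 1) = 4) * ('C(4, 2) = 6) * ('C(4, 3) = 4) * ('C(4, 4) = 1).
  by [].
have bin2 : ('C(2, 0) = 1) * ('C(2, 1) = 2) * ('C(2, 2) = 1) by [].
rewrite !binom !big_ord_recl !big_ord0/= /bump/= !add1n !subSS !subn0 !bin4 !bin2.
rewrite c0 c1 c2 c3 c4; ring.
Qed.

(** * Polarization *)

(** The parameters stay existential because the fourth-moment identity mentions raw moments only. *)
Definition gaussian_rv d (T : measurableType d) (R : realType)
    (P : probability T R) (Y : T -> R) : Prop :=
  measurable_fun setT Y /\
  exists m s : R, forall A, measurable A -> pushforward P Y A = gauss_law m s A.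

Section gaussian_pair.
Context d (T : measurableType d) (R : realType) (P : probability T R).
Variables Y1 Y2 : T -> R.
Hypothesis gY : forall a b, gaussian_rv P (fun t => a * Y1 t + b * Y2 t).

Let comb (ab : R * R) t : R := ab.1 * Y1 t + ab.2 * Y2 t.

Let int_comb k ab : P.-integrable setT (EFin \o (fun t => comb ab t ^+ k)).
Proof. by have [mY [m [s lawY]]] := gY ab.1 ab.2; exact: gauss_law_integrableX lawY. Qed.

(** An entry of [r] is a coefficient with the pair (a, b) of a combination, so that a polarization
    identity is a list and its proof a polynomial identity. *)
Let integrable_comb k (r : seq (R * (R * R))) (f : T -> R) :
  (forall t, f t = \sum_(i <- r) i.1 * comb i.2 t ^+ k) ->
  P.-integrable setT (EFin \o f).
Proof. by move=> /funext ->; apply: integrable_lincomb => i; exact: int_comb. Qed.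

Let Rintegral_comb k (r : seq (R * (R * R))) (f : T -> R) :
  (forall t, f t = \sum_(i <- r) i.1 * comb i.2 t ^+ k) ->
  \int[P]_t f t = \sum_(i <- r) i.1 * \int[P]_t (comb i.2 t ^+ k).
Proof. by move=> /funext ->; apply: Rintegral_lincomb => i; exact: int_comb. Qed.

Let expand := (big_cons, big_nil, @addr0 R).

Let prodE t : Y1 t * Y2 t =
  \sum_(i <- [:: (1 / 4, (1, 1)); (- (1 / 4), (1, -1))]) i.1 * comb i.2 t ^+ 2.
Proof. by rewrite !expand/= /comb/=; field. Qed.

(** In (x + y)^4 + (x - y)^4 the odd mixed terms cancel, leaving 2 x^4 + 12 x^2 y^2 + 2 y^4. *)
Let sqrE t : Y1 t ^+ 2 * Y2 t ^+ 2 =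
  \sum_(i <- [:: (1 / 12, (1, 1)); (1 / 12, (1, -1));
                 (- (1 / 6), (1, 0)); (- (1 / 6), (0, 1))]) i.1 * comb i.2 t ^+ 4.
Proof. by rewrite !expand/= /comb/=; field. Qed.

Lemma integrable_gaussian_pair1 : P.-integrable setT (EFin \o Y1).
Proof.
by apply: (@integrable_comb 1 [:: (1, (1, 0))]) => t; rewrite !expand/= /comb/=; ring.
Qed.

Lemma integrable_gaussian_pair_mul :
  P.-integrable setT (EFin \o (fun t => Y1 t * Y2 t)).
Proof. exact: integrable_comb prodE. Qed.

Lemma integrable_gaussian_pair_sqr_mul :
  P.-integrable setT (EFin \o (fun t => Y1 t ^+ 2 * Y2 t ^+ 2)).
Proof. exact: integrable_comb sqrE. Qed.

Lemma Rintegral_gaussian_pair_sqr_mul :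
  \int[P]_t (Y1 t ^+ 2 * Y2 t ^+ 2) =
    \int[P]_t (Y1 t ^+ 2) * \int[P]_t (Y2 t ^+ 2) +
    2 * (\int[P]_t (Y1 t * Y2 t)) ^+ 2 -
    2 * (\int[P]_t Y1 t) ^+ 2 * (\int[P]_t Y2 t) ^+ 2.
Proof.
(* [M k a b] is the k-th moment of a Y1 + b Y2. By [M4] every fourth moment reduces to moments of
   orders 1 and 2. *)
pose M k a b := \int[P]_t (comb (a, b) t ^+ k).
have M4 a b : M 4 a b = 3 * M 2 a b ^+ 2 - 2 * M 1 a b ^+ 4.
  have [mY [m [s lawY]]] := gY a b.
  by rewrite /M (gauss_law_fourth_moment mY lawY).
have -> : \int[P]_t Y1 t = M 1 1 0.
  by apply: eq_Rintegral => t _; rewrite /comb/=; ring.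
have -> : \int[P]_t Y2 t = M 1 0 1.
  by apply: eq_Rintegral => t _; rewrite /comb/=; ring.
have -> : \int[P]_t (Y1 t ^+ 2) = M 2 1 0.
  by apply: eq_Rintegral => t _; rewrite /comb/=; ring.
have -> : \int[P]_t (Y2 t ^+ 2) = M 2 0 1.
  by apply: eq_Rintegral => t _; rewrite /comb/=; ring.
have M1p : M 1 1 1 = M 1 1 0 + M 1 0 1.
  rewrite {1}/M (@Rintegral_comb 1 [:: (1, (1, 0)); (1, (0, 1))]) => [|t].
    by rewrite !expand/= !mul1r.
  by rewrite !expand/= /comb/=; ring.
have M1m : M 1 1 (-1) = M 1 1 0 - M 1 0 1.
  rewrite {1}/M (@Rintegral_comb 1 [:: (1, (1, 0)); (-1, (0, 1))]) => [|t].
    by rewrite !expand/= mul1r mulN1r.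
  by rewrite !expand/= /comb/=; ring.
(* The parallelogram law removes the last dependent second moment; the remaining claim is a
   polynomial identity in independent quantities. *)
have M2p : M 2 1 1 = 2 * M 2 1 0 + 2 * M 2 0 1 - M 2 1 (-1).
  rewrite {1}/M (@Rintegral_comb 2 [:: (2, (1, 0)); (2, (0, 1)); (-1, (1, -1))]) => [|t].
    by rewrite !expand/= mulN1r addrA.
  by rewrite !expand/= /comb/=; ring.
rewrite (Rintegral_comb sqrE) (Rintegral_comb prodE) !expand/= -!/(M _ _ _).
by rewrite !M4 M1p M1m M2p; field.
Qed.

End gaussian_pair.

(** * Real coordinates of a complex Gaussian vector *)

Section real_coordinates.
Context {R : realType} {n : nat}.
Implicit Types v w : 'cV[R[i]]_n.

(* (i, false) and (i, true) index the real and the imaginary part of v i. *)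
Definition rcoord v (p : 'I_n * bool) : R :=
  if p.2 then complex.Im (v p.1 0) else complex.Re (v p.1 0).

Lemma sum_rcoord (F : 'I_n -> bool -> R) :
  \sum_(p : 'I_n * bool) F p.1 p.2 = \sum_i (F i false + F i true).
Proof.
rewrite -(pair_bigA _ F)/=; apply: eq_bigr => i _.
by rewrite big_bool addrC.
Qed.

(** This identifies the real part of the Hermitian product with the inner product of R^(2n), hence
    the combinations in [jointly_gaussian] with those of the real coordinates. *)
Lemma Re_cdot w v : complex.Re (cdot w v) = \sum_p rcoord w p * rcoord v p.
Proof.
rewrite /cdot mxE raddf_sum (sum_rcoord (fun i b => rcoord w (i, b) * rcoord v (i, b))).
apply: eq_bigr => i _; rewrite !mxE /rcoord/=.
by case: (w i 0) => a b; case: (v i 0) => a' b' /=; rewrite mulNr opprK.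
Qed.

Lemma enorm_sqr v : enorm v ^+ 2 = \sum_p rcoord v p ^+ 2.
Proof.
rewrite /enorm sqr_sqrtr ?sumr_ge0// => [|i _]; last exact: sqr_ge0.
rewrite (sum_rcoord (fun i b => rcoord v (i, b) ^+ 2)); apply: eq_bigr => i _.
rewrite /rcoord/=; case: (v i 0) => a b /=.
by rewrite sqr_sqrtr// addr_ge0// sqr_ge0.
Qed.

Lemma cdot_self v : cdot v v = (\sum_p rcoord v p ^+ 2)%:C.
Proof.
rewrite /cdot mxE (sum_rcoord (fun i b => rcoord v (i, b) ^+ 2)) rmorph_sum/=.
apply: eq_bigr => i _; rewrite !mxE /rcoord/=; case: (v i 0) => a b.
by apply/eqP; rewrite eq_complex/=; apply/andP; split; apply/eqP; ring.
Qed.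

End real_coordinates.

Definition coord_mean d (T : measurableType d) (R : realType)
    (P : probability T R) (n : nat) (X : T -> 'cV[R[i]]_n) (p : 'I_n * bool) : R :=
  \int[P]_t rcoord (X t) p.

(** Raw rather than centered form, to match the polarized moment formula; [Rintegral_cov] recovers
    the centered form. *)
Definition coord_cov d (T : measurableType d) (R : realType)
    (P : probability T R) (n : nat) (X : T -> 'cV[R[i]]_n) (p q : 'I_n * bool) : R :=
  \int[P]_t (rcoord (X t) p * rcoord (X t) q) - coord_mean P X p * coord_mean P X q.

(** * Moments and covariance of a complex Gaussian vector *)

Section complex_gaussian_vector.
Context d (T : measurableType d) (R : realType) (P : probability T R).
Variables (n : nat) (X : T -> 'cV[R[i]]_n) (u : 'cV[R[i]]_n) (S : 'M[R[i]]_n).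
Hypothesis gX : complex_gaussian P X u S.

(** This provides the hypothesis of the section on Gaussian pairs for any two real coordinates. *)
Lemma gaussian_rcoord p q (a b : R) :
  gaussian_rv P (fun t => a * rcoord (X t) p + b * rcoord (X t) q).
Proof.
have [[mX jX] _ _ _] := gX.
have mcoord r : measurable_fun setT (fun t => rcoord (X t) r).
  by have [mRe mIm] := mX r.1; rewrite /rcoord; case: r.2.
split; first by apply: measurable_funD; exact: measurable_funM.
(* Adding the two indicators, instead of distinguishing cases, also covers p = q, where the weight
   is a + b. *)
pose c r : R := a * (r == p)%:R + b * (r == q)%:R.
pose w : 'cV[R[i]]_n := \col_i (c (i, false) +i* c (i, true)).
have [m [s lawX]] := jX w.
exists m, s => A mA; rewrite -lawX// /pushforward; congr (P (_ @^-1` A)).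
apply/funext => t; rewrite Re_cdot.
under eq_bigr => r _.
  rewrite (_ : rcoord w r = c r); last by case: r => i []; rewrite /rcoord !mxE.
  rewrite mulrDl -!mulrA; over.
rewrite big_split/= -!mulr_sumr; congr (_ * _ + _ * _).
  by rewrite (bigD1 p)//= eqxx mul1r big1 ?addr0// => r /negbTE ->; rewrite mul0r.
by rewrite (bigD1 q)//= eqxx mul1r big1 ?addr0// => r /negbTE ->; rewrite mul0r.
Qed.

Local Notation m := (coord_mean P X).
Local Notation K := (coord_cov P X).

Lemma rcoord_mean p : rcoord u p = m p.
Proof.
have [_ <- _ _] := gX; rewrite /rcoord mxE /cexpectation unlock.
by case: p => i [].
Qed.

Let int1 p : P.-integrable setT (EFin \o (fun t => rcoord (X t) p)).
Proof. exact: integrable_gaussian_pair1 (gaussian_rcoord p p). Qed.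

Let int2 p q : P.-integrable setT (EFin \o (fun t => rcoord (X t) p * rcoord (X t) q)).
Proof. exact: integrable_gaussian_pair_mul (gaussian_rcoord p q). Qed.

Let int4 p q :
  P.-integrable setT (EFin \o (fun t => rcoord (X t) p ^+ 2 * rcoord (X t) q ^+ 2)).
Proof. exact: integrable_gaussian_pair_sqr_mul (gaussian_rcoord p q). Qed.

(* The coefficients 1 are those of [integrable_lincomb]. *)
Let enorm4E t : enorm (X t) ^+ 4 =
  \sum_(pq : ('I_n * bool) * ('I_n * bool))
    1 * (rcoord (X t) pq.1 ^+ 2 * rcoord (X t) pq.2 ^+ 2).
Proof.
rewrite -[4%N]/(2 * 2)%N exprM enorm_sqr expr2 big_distrlr/= pair_bigA/=.
by apply: eq_bigr => pq _; rewrite mul1r.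
Qed.

Lemma integrable_enorm4 : P.-integrable setT (EFin \o (fun t => enorm (X t) ^+ 4)).
Proof.
rewrite (_ : (fun t => _) = (fun t =>
  \sum_(pq : ('I_n * bool) * ('I_n * bool))
    1 * (rcoord (X t) pq.1 ^+ 2 * rcoord (X t) pq.2 ^+ 2))).
  by apply: integrable_lincomb => pq; exact: int4.
by apply/funext => t; exact: enorm4E.
Qed.

(** Put E X_p X_q = K p q + m p m q in the polarized formula: in 2 (E X_p X_q)^2 the term 2 (m p)^2
    (m q)^2 cancels, leaving 2 (K p q)^2 + 4 K p q m p m q. *)
Lemma Rintegral_enorm4 : \int[P]_t (enorm (X t) ^+ 4) =
  (\sum_p K p p + \sum_p m p ^+ 2) ^+ 2 + 2 * (\sum_p \sum_q K p q ^+ 2) +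
  4 * (\sum_p \sum_q K p q * (m p * m q)).
Proof.
under eq_Rintegral do rewrite enorm4E.
rewrite Rintegral_lincomb => [|pq]; last exact: int4.
rewrite -big_split expr2 big_distrlr/= !pair_bigA/= !mulr_sumr -!big_split/=.
apply: eq_bigr => -[p q] _ /=.
rewrite (Rintegral_gaussian_pair_sqr_mul (gaussian_rcoord p q)).
rewrite -!/(m _) /coord_cov.
have sqrE r : \int[P]_t (rcoord (X t) r * rcoord (X t) r) = \int[P]_t (rcoord (X t) r ^+ 2).
  by apply: eq_Rintegral => t _; rewrite expr2.
by rewrite !sqrE; ring.
Qed.

(** * Complex covariance in terms of the real one *)

Let int_cst (c : R) : P.-integrable setT (EFin \o (fun=> c)).
Proof. exact: finite_measure_integrable_cst. Qed.

Let cov p q t := (rcoord (X t) p - m p) * (rcoord (X t) q - m q).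

Let covE p q t : cov p q t =
  rcoord (X t) p * rcoord (X t) q - m q * rcoord (X t) p -
  (m p * rcoord (X t) q - m p * m q).
Proof. by rewrite /cov; ring. Qed.

Let intZ c p : P.-integrable setT (EFin \o (fun t => c * rcoord (X t) p)).
Proof. exact: (integrableZl measurableT c (int1 p)). Qed.

Let intB1 p q : P.-integrable setT
  (EFin \o (fun t => rcoord (X t) p * rcoord (X t) q - m q * rcoord (X t) p)).
Proof. exact: (integrableB measurableT (int2 p q) (intZ _ _)). Qed.

Let intB2 p q : P.-integrable setT
  (EFin \o (fun t => m p * rcoord (X t) q - m p * m q)).
Proof. exact: (integrableB measurableT (intZ _ _) (int_cst _)). Qed.

Let integrable_cov p q : P.-integrable setT (EFin \o cov p q).
Proof.
rewrite (funext (covE p q)).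
exact: (integrableB measurableT (intB1 p q) (intB2 p q)).
Qed.

Let Rintegral_cov p q : \int[P]_t cov p q t = K p q.
Proof.
rewrite (funext (covE p q)) RintegralB// RintegralB// RintegralB// !RintegralZl//.
rewrite Rintegral_cst// (_ : fine _ = 1); last exact: (congr1 fine (probability_setT P)).
by rewrite -!/(m _) /coord_cov; ring.
Qed.

Let KC p q : K p q = K q p.
Proof.
rewrite /coord_cov (mulrC (m p)); congr (_ - _).
by apply: eq_Rintegral => t _; rewrite mulrC.
Qed.

Let Ksum p q r s : \int[P]_t (cov p q t + cov r s t) = K p q + K r s.
Proof. by rewrite RintegralD ?Rintegral_cov//; exact: integrable_cov. Qed.

Let Kdif p q r s : \int[P]_t (cov p q t - cov r s t) = K p q - K r s.
Proof. by rewrite RintegralB ?Rintegral_cov//; exact: integrable_cov. Qed.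

Let ReXu t i : complex.Re (X t i 0 - u i 0) = rcoord (X t) (i, false) - m (i, false).
Proof. by rewrite raddfB -rcoord_mean. Qed.

Let ImXu t i : complex.Im (X t i 0 - u i 0) = rcoord (X t) (i, true) - m (i, true).
Proof. by rewrite raddfB -rcoord_mean. Qed.

(** Expansion of (a + ib)(a' - ib') for the centered entries i and j. *)
Lemma covariance_entry i j : S i j =
  (K (i, false) (j, false) + K (i, true) (j, true)) +i*
  (K (i, true) (j, false) - K (i, false) (j, true)).
Proof.
have [_ _ <- _] := gX; rewrite mxE /cexpectation unlock -Ksum -Kdif.
by congr (_ +i* _); apply: eq_Rintegral => t _; rewrite !mxE big_ord1 !mxE /cov;
  rewrite -!ReXu -!ImXu; case: (X t i 0 - u i 0) => a b;
  case: (X t j 0 - u j 0) => a' b' /=; ring.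
Qed.

(** Real and imaginary parts of (a + ib)(a' + ib') have mean 0. Hence, writing f and t for [false]
    and [true], S i j = 2 (K_ff - i K_ft) at the entries i, j. *)
Lemma pseudo_covariance_entry i j :
  K (i, false) (j, false) = K (i, true) (j, true) /\
  K (i, true) (j, false) = - K (i, false) (j, true).
Proof.
have [_ _ _ /matrixP /(_ i j)] := gX; rewrite !mxE /cexpectation unlock => -[re0 im0].
split; apply/eqP.
  rewrite -subr_eq0 -Kdif -[X in _ == X]re0; apply/eqP.
  apply: eq_Rintegral => t _; rewrite !mxE big_ord1 !mxE /cov.
  rewrite -!ReXu -!ImXu; case: (X t i 0 - u i 0) => a b.
  by case: (X t j 0 - u j 0) => a' b'.
rewrite -addr_eq0 -Ksum -[X in _ == X]im0; apply/eqP.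
apply: eq_Rintegral => t _; rewrite !mxE big_ord1 !mxE /cov.
rewrite -!ReXu -!ImXu; case: (X t i 0 - u i 0) => a b.
by case: (X t j 0 - u j 0) => a' b' /=; ring.
Qed.

Let sum2 (F : 'I_n -> bool -> 'I_n -> bool -> R) :
  \sum_(p : 'I_n * bool) \sum_(q : 'I_n * bool) F p.1 p.2 q.1 q.2 =
  \sum_i \sum_j (F i false j false + F i false j true + F i true j false + F i true j true).
Proof.
rewrite (sum_rcoord (fun i b => \sum_(q : 'I_n * bool) F i b q.1 q.2)).
apply: eq_bigr => i _.
rewrite (sum_rcoord (F i false)) (sum_rcoord (F i true)) -big_split/=.
by apply: eq_bigr => j _; rewrite !addrA.
Qed.

Lemma trace_covariance : \tr S = (\sum_p K p p)%:C.
Proof.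
rewrite (sum_rcoord (fun i b => K (i, b) (i, b))) rmorph_sum/=.
apply: eq_bigr => i _; rewrite covariance_entry (KC (i, true) (i, false)) subrr.
by [].
Qed.

(** As S is Hermitian, the trace is the sum of |S i j|^2 = 4 (K_ff^2 + K_ft^2), while the four real
    entries at i, j have squares summing to 2 (K_ff^2 + K_ft^2). *)
Lemma trace_covariance_sqr : \tr (S *m S) = (2 * (\sum_p \sum_q K p q ^+ 2))%:C.
Proof.
rewrite (sum2 (fun i b j c => K (i, b) (j, c) ^+ 2)) mulr_sumr rmorph_sum/=.
apply: eq_bigr => i _; rewrite mxE mulr_sumr rmorph_sum/=; apply: eq_bigr => j _.
rewrite !covariance_entry (KC (j, false)) (KC (j, true) (i, true)).
rewrite (KC (j, true)) (KC (j, false)).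
have [-> ->] := pseudo_covariance_entry i j.
by apply/eqP; rewrite eq_complex/=; apply/andP; split; apply/eqP; ring.
Qed.

(** The real part of each term conj(u i) (S i j) (u j) is already twice the contribution of i, j to
    the real quadratic form; imaginary parts vanish only after summation. *)
Lemma quadratic_covariance : (u^t* *m S *m u) 0 0 =
  (2 * (\sum_p \sum_q K p q * (m p * m q)))%:C.
Proof.
rewrite (sum2 (fun i b j c => K (i, b) (j, c) * (m (i, b) * m (j, c)))) mulr_sumr.
have uE i : u i 0 = m (i, false) +i* m (i, true).
  by rewrite -!rcoord_mean /rcoord; case: (u i 0).
(* The imaginary parts of the terms are antisymmetric, hence sum to 0. *)
pose g i j :=
  2 * K (i, false) (j, false) * (m (i, false) * m (j, true) - m (i, true) * m (j, false)) -
  2 * K (i, false) (j, true) * (m (i, false) * m (j, false) + m (i, true) * m (j, true)).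
(* Exchanging i and j fixes K_ff and negates its bracket, whereas it negates K_ft and fixes its
   bracket. *)
have gN i j : g j i = - g i j.
  rewrite /g (KC (j, false) (i, false)) (KC (j, false) (i, true)).
  by have [_ ->] := pseudo_covariance_entry i j; ring.
have g0 : \sum_i \sum_j g i j = 0.
  have : \sum_i \sum_j g i j = - \sum_i \sum_j g i j.
    rewrite {1}exchange_big -sumrN; apply: eq_bigr => i _; rewrite -sumrN.
    by apply: eq_bigr => j _.
  by move=> h; lra.
have -> : (u^t* *m S *m u) 0 0 = \sum_i \sum_j ((u i 0)^* * S i j * u j 0).
  rewrite mxE exchange_big/=; apply: eq_bigr => j _; rewrite mxE mulr_suml.
  by apply: eq_bigr => i _; rewrite !mxE.
transitivity (\sum_i \sum_j ((2 * (K (i, false) (j, false) * (m (i, false) * m (j, false)) +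
   K (i, false) (j, true) * (m (i, false) * m (j, true)) +
   K (i, true) (j, false) * (m (i, true) * m (j, false)) +
   K (i, true) (j, true) * (m (i, true) * m (j, true)))) +i* g i j)).
  apply: eq_bigr => i _; apply: eq_bigr => j _; rewrite !uE covariance_entry /g.
  have [-> ->] := pseudo_covariance_entry i j.
  by apply/eqP; rewrite eq_complex/=; apply/andP; split; apply/eqP; ring.
apply/eqP; rewrite eq_complex/= !raddf_sum/=; apply/andP; split; apply/eqP.
  by apply: eq_bigr => i _; rewrite mulr_sumr raddf_sum.
by rewrite -[RHS]g0; apply: eq_bigr => i _; rewrite raddf_sum.
Qed.

Lemma complex_gaussian_fourth_moment : let a := ('E_P[fun t => (enorm (X t) ^+ 4)%R])%E in
  [/\ a = ('E_P[fun t => (Normc.normc (cdot (X t) (X t)) ^+ 2)%R])%E,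
      a \is a fin_num &
      (fine a)%:C =
        `|\tr S| ^+ 2 + `|\tr (S *m S)| + `|cdot u u| ^+ 2
        + 2 * cdot u u * \tr S + 2 * (u^t* *m S *m u) 0 0 ].
Proof.
move=> a; split.
- congr (expectation P _); apply/funext => t.
  rewrite cdot_self /= expr0n/= addr0 sqr_sqrtr ?sqr_ge0//.
  by rewrite -[4%N]/(2 * 2)%N exprM enorm_sqr.
(* Finiteness ensures that [fine] returns the expectation itself and not its default value 0. *)
- by rewrite /a unlock integrable_fin_num//; exact: integrable_enorm4.
rewrite /a unlock -/(Rintegral _ _ _) Rintegral_enorm4.
rewrite trace_covariance trace_covariance_sqr quadratic_covariance cdot_self.
have -> : \sum_p rcoord u p ^+ 2 = \sum_p m p ^+ 2.
  by apply: eq_bigr => p _; rewrite rcoord_mean.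
set k := \sum_p K p p; set w := \sum_p m p ^+ 2.
set b := \sum_p \sum_q _ ^+ 2; set q := \sum_p \sum_q _.
have b0 : 0 <= b by apply: sumr_ge0 => p _; apply: sumr_ge0 => r _; exact: sqr_ge0.
have normC (x : R) : `|x%:C| = `|x|%:C by rewrite normc_def/= expr0n/= addr0 sqrtr_sqr.
rewrite !normC (ger0_norm (x := 2 * b)) ?mulr_ge0//.
rewrite -!rmorphXn !real_normK ?num_real//=.
by apply/eqP; rewrite eq_complex/=; apply/andP; split; apply/eqP; ring.
Qed.

End complex_gaussian_vector.

(** * Specialization to the estimated channel, with mean [gbar] and covariance [Sigma] *)

Theorem lemma1 (d : measure_display) (T : measurableType d) (R : realType)
    (P : probability T R) (M K S N : nat) (L : eqType)
    (F : 'I_M -> 'M[R[i]]_(S, N)) (zbar : 'I_M -> 'I_K -> 'cV[R[i]]_S)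
    (beta : 'I_M -> 'I_K -> R) (kappa : R) (pilot : 'I_K -> L)
    (tau : nat) (rhou sigman2 : R) (m : 'I_M) (k : 'I_K)
    (ghat : T -> 'cV[R[i]]_N)
    (beta_gt0 : forall (m' : 'I_M) (k' : 'I_K), 0 < beta m' k')
    (kappa_ge0 : 0 <= kappa) (rhou_ge0 : 0 <= rhou) (sigman2_gt0 : 0 < sigman2) :
  let g := gbar F zbar beta kappa m k in
  let Sg := Sigma F beta pilot tau rhou sigman2 m k in
  complex_gaussian P ghat g Sg ->
  let abar := ('E_P[fun t => (enorm (ghat t) ^+ 4)%R])%E in
  [/\ abar = ('E_P[fun t => (Normc.normc (cdot (ghat t) (ghat t)) ^+ 2)%R])%E,
      abar \is a fin_num &
      (fine abar)%:C =
        `|\tr Sg| ^+ 2 + `|\tr (Sg *m Sg)| + `|cdot g g| ^+ 2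
        + 2 * cdot g g * \tr Sg + 2 * (g^t* *m Sg *m g) 0 0 ].
Proof. by move=> g Sg gX; exact: complex_gaussian_fourth_moment gX. Qed.
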